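(* Let $K$ be an infinite field which is not of characteristic $2$ and whose absolute Galois group $G_K$ is finitely generated as a topological group. Then for every split hyperelliptic curve $X/K$, we have $|X(K)|=\infty$.
   Context: For a field $K$, fix a separable closure $K^{\mathrm{sep}}$ and let $G_K:=\operatorname{Gal}(K^{\mathrm{sep}}/K)$ with its profinite topology. For $K$ not of characteristic $2$, a split hyperelliptic curve over $K$ is a curve $X/K$ which has an affine open set of the form $\operatorname{Spec} K[x,y]/(y^2-(x-a_1)\cdots(x-a_{2g+2}))$, where $g$ is a positive integer and the $a_i$ are pairwise distinct elements of $K$. *)

(* Defs.v *)
From HB Require Import structures.
From mathcomp Require Import all_boot all_order all_algebra.
From mathcomp Require Import qpoly separable.
From mathcomp Require Import all_classical.
From mathcomp Require Import topology.

Set Implicit Arguments.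
Unset Strict Implicit.
Unset Printing Implicit Defensive.

Import GRing.Theory.
Local Open Scope classical_set_scope.
Local Open Scope ring_scope.

(* * Separable closures and absolute Galois groups *)

Definition separable_over (K : fieldType) (L : fieldType)
    (iota : {rmorphism K -> L}) (x : L) : Prop :=
  exists p : {poly K},
    [/\ irreducible_poly p, separable_poly p & root (map_poly iota p) x].

Definition separably_closed (L : fieldType) : Prop :=
  forall p : {poly L},
    separable_poly p -> (1 < size p)%N -> exists x, root p x.

Definition separable_closure (K : fieldType) (L : fieldType)
    (iota : {rmorphism K -> L}) : Prop :=
  (forall x, separable_over iota x) /\ separably_closed L.

Section Galois.
Variables (K L : fieldType) (iota : {rmorphism K -> L}).

(* The automorphisms of L over K. The inverse is stored as data, but it is
   determined by the underlying function, see [gal_eqP]. *)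
Record gal := Gal {
  gal_fun :> L -> L;
  gal_inv : L -> L;
  gal_funK : cancel gal_fun gal_inv;
  gal_invK : cancel gal_inv gal_fun;
  gal_zmod : zmod_morphism gal_fun;
  gal_monoid : monoid_morphism gal_fun;
  gal_fix : forall c, gal_fun (iota c) = iota c
}.

Lemma gal_eqP (s t : gal) : s =1 t -> s = t.
Proof.
case: s t => [s s' sK s'K sa sm sf] [t t' tK t'K ta tm tf] /= /funext st.
rewrite -{t}st in tK t'K ta tm tf *.
have /funext s't' : s' =1 t' by move=> x; rewrite -{1}(t'K x) sK.
rewrite -{t'}s't' in tK t'K *.
by congr Gal; exact: Prop_irrelevance.
Qed.

Definition gal1 : gal :=
  @Gal id id (frefl _) (frefl _) (fun _ _ => erefl)
    (erefl, fun _ _ => erefl) (fun=> erefl).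

Definition galM (s t : gal) : gal.
Proof.
exists (s \o t) (gal_inv t \o gal_inv s).
- exact: can_comp (@gal_funK s) (@gal_funK t).
- exact: can_comp (@gal_invK t) (@gal_invK s).
- by move=> x y /=; rewrite !gal_zmod.
- split=> [|x y] /=; first by rewrite !(gal_monoid _).1.
  by rewrite !(gal_monoid _).2.
- by move=> c /=; rewrite !gal_fix.
Defined.

Definition galV (s : gal) : gal.
Proof.
exists (gal_inv s) s.
- exact: gal_invK.
- exact: gal_funK.
- move=> x y.
  by rewrite -{1}(gal_invK s x) -{1}(gal_invK s y) -gal_zmod gal_funK.
- split=> [|x y]; first by rewrite -{1}(gal_monoid s).1 gal_funK.
  by rewrite -{1}(gal_invK s x) -{1}(gal_invK s y) -(gal_monoid s).2 gal_funK.
- by move=> c; rewrite -{1}(gal_fix s c) gal_funK.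
Defined.

HB.instance Definition _ := gen_eqMixin gal.
HB.instance Definition _ := gen_choiceMixin gal.

Lemma galMA : associative galM. Proof. by move=> s t u; exact: gal_eqP. Qed.
Lemma gal1M : left_id gal1 galM. Proof. by move=> s; exact: gal_eqP. Qed.
Lemma galM1 : right_id gal1 galM. Proof. by move=> s; exact: gal_eqP. Qed.
Lemma galVM : left_inverse gal1 galV galM.
Proof. by move=> s; apply: gal_eqP => x /=; exact: gal_funK. Qed.
Lemma galMV : right_inverse gal1 galV galM.
Proof. by move=> s; apply: gal_eqP => x /=; exact: gal_invK. Qed.

HB.instance Definition _ := isGroup.Build gal galMA gal1M galM1 galVM galMV.

(* The Krull topology: the sets of those t that agree with s on a finite
   subset l of L are the cosets of Gal(L/K(l)), and these cosets form a
   fundamental system of neighbourhoods of s. *)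
Definition krull_open : set_system gal :=
  [set U : set gal | forall s : gal, U s ->
     exists l : seq L, forall t : gal, {in l, t =1 s} -> U t].

Lemma krull_openT : krull_open setT.
Proof. by move=> s _; exists [::]. Qed.

Lemma krull_openI : setI_closed krull_open.
Proof.
move=> U V oU oV s [/oU[l lU] /oV[m mV]]; exists (l ++ m) => t ts.
by split; [apply: lU | apply: mV] => x xl; apply: ts; rewrite mem_cat xl ?orbT.
Qed.

Lemma krull_open_bigcup (I : Type) (f : I -> set gal) :
  (forall i, krull_open (f i)) -> krull_open (\bigcup_i f i).
Proof.
by move=> of_ s [i _ /of_[l lf]]; exists l => t /lf fit; exists i.
Qed.

HB.instance Definition _ :=
  isOpenTopological.Build gal krull_openT krull_openI krull_open_bigcup.

End Galois.

Definition subgroup (G : groupType) (H : set G) : Prop :=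
  [/\ H 1%g, forall x y, H x -> H y -> H (x * y)%g & forall x, H x -> H x^-1%g].

Definition gal_topologically_fg (K L : fieldType)
    (iota : {rmorphism K -> L}) : Prop :=
  exists s : seq (gal iota), dense (smallest (@subgroup (gal iota)) [set` s]).

(* * Commutative algebras over K *)

(* [comAlgType K] excludes the zero algebra, which is needed here, so an
   algebra is a commutative ring with a structural morphism from K. *)
Record kalg (K : fieldType) := KAlg {
  kring :> comPzRingType;
  kstruct : {rmorphism K -> kring}
}.

Record khom (K : fieldType) (A B : kalg K) := KHom {
  khom_fun :> {rmorphism A -> B};
  khom_struct : forall c, khom_fun (kstruct A c) = kstruct B c
}.

Section KAlg.
Variable K : fieldType.
Implicit Types A B C R : kalg K.

Lemma khom_eqP A B (f g : khom A B) : f =1 g -> f = g.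
Proof.
case: f g => [[f [[fa] [fm]]] fs] [[g [[ga] [gm]]] gs] /= /funext fg; subst g.
move: fs gs; rewrite (Prop_irrelevance fa ga) (Prop_irrelevance fm gm) => fs gs.
by congr KHom; exact: Prop_irrelevance.
Qed.

Definition khom_id A : khom A A :=
  @KHom K A A idfun (fun=> erefl).

Definition khom_comp A B C (g : khom B C) (f : khom A B) : khom A C.
Proof.
exists (g \o f : {rmorphism A -> C}).
by move=> c /=; rewrite !khom_struct.
Defined.

Definition base_alg : kalg K := @KAlg K K idfun.

Definition unit_ideal (A : comPzRingType) (S : set A) : Prop :=
  exists (n : nat) (c s : 'I_n -> A),
    (forall i, S (s i)) /\ \sum_(i < n) c i * s i = 1.

(* The elementwise characterization of B = A[1/f]. *)
Definition localization A B (l : khom A B) (f : A) : Prop :=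
  [/\ exists b, l f * b = 1,
      forall b, exists n a, l f ^+ n * b = l a
    & forall a, l a = 0 -> exists n, f ^+ n * a = 0].

Definition alg_fg A : Prop :=
  exists s : seq A, forall B : set A,
    [set` s] `<=` B -> range (kstruct A) `<=` B ->
    (forall x y, B x -> B y -> B (x + y)) ->
    (forall x y, B x -> B y -> B (x * y)) -> B = setT.

Definition reduced_ring (A : comPzRingType) : Prop :=
  forall (a : A) (n : nat), a ^+ n = 0 -> a = 0.

Definition prime_ideal (A : comPzRingType) (P : set A) : Prop :=
  [/\ P 0, forall x y, P x -> P y -> P (x + y), forall a x, P x -> P (a * x),
      ~ P 1 & forall x y, P (x * y) -> P x \/ P y].

Definition prime_chain (A : comPzRingType) (n : nat) : Prop :=
  exists P : 'I_n.+1 -> set A, (forall i, prime_ideal (P i)) /\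
    forall i j : 'I_n.+1, (i < j)%N -> P i `<` P j.

End KAlg.

(* * Schemes over K, by their functors of points (Demazure-Gabriel) *)

Record kfunctor (K : fieldType) := KFunctor {
  points :> kalg K -> Type;
  kmap : forall A B : kalg K, khom A B -> points A -> points B;
  kmap_id : forall (A : kalg K) (x : points A), kmap (khom_id A) x = x;
  kmap_comp : forall (A B C : kalg K) (g : khom B C) (f : khom A B)
    (x : points A), kmap (khom_comp g f) x = kmap g (kmap f x)
}.
Arguments kmap {K} X {A B} f x : rename.

Record kmor (K : fieldType) (X Y : kfunctor K) := KMor {
  kmor_fun :> forall A : kalg K, X A -> Y A;
  kmor_nat : forall (A B : kalg K) (f : khom A B) (x : X A),
    kmor_fun (kmap X f x) = kmap Y f (kmor_fun x)
}.

Section Schemes.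
Variable K : fieldType.
Implicit Types (X Y : kfunctor K) (A B R : kalg K).

Definition Spec R : kfunctor K.
Proof.
exists (khom R) (fun A B (f : khom A B) (x : khom R A) => khom_comp f x).
- by move=> A x; exact: khom_eqP.
- by move=> A B C g f x; exact: khom_eqP.
Defined.

(* The inverse image of U along every x : Spec A -> X is required to be the
   complement of the common zero locus of some subset I of A. Taking f = id
   shows that such a U is automatically stable under [kmap]. *)
Definition open_subfunctor X (U : forall A, set (X A)) : Prop :=
  forall A (x : X A), exists I : set A, forall B (f : khom A B),
    U B (kmap X f x) <-> unit_ideal (f @` I).

Definition open_immersion Y X (j : kmor Y X) : Prop :=
  (forall A, injective (@kmor_fun K Y X j A)) /\
  open_subfunctor (fun A => range (@kmor_fun K Y X j A)).

(* A point of the underlying space is represented by a point with values in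
   a field extension L of K. *)
Definition nonempty_subfunctor X (U : forall A, set (X A)) : Prop :=
  exists (L : fieldType) (e : {rmorphism K -> L}), U (KAlg e) !=set0.

Definition affine_open_cover X (I : Type) (R : I -> kalg K)
    (j : forall i, kmor (Spec (R i)) X) : Prop :=
  (forall i, open_immersion (j i)) /\
  forall (L : fieldType) (e : {rmorphism K -> L}) (x : X (KAlg e)),
    exists i, range (@kmor_fun K _ X (j i) (KAlg e)) x.

(* the sheaf condition for the coverings of Spec A by the Spec A[1/f_i] *)
Definition zariski_local X : Prop :=
  forall A (n : nat) (f : 'I_n -> A)
    (S : 'I_n -> kalg K) (l : forall i, khom A (S i))
    (T : 'I_n -> 'I_n -> kalg K)
    (p : forall i j, khom (S i) (T i j)) (q : forall i j, khom (S j) (T i j)),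
  unit_ideal (range f) ->
  (forall i, localization (l i) (f i)) ->
  (forall i j, khom_comp (p i j) (l i) = khom_comp (q i j) (l j)) ->
  (forall i j, localization (khom_comp (p i j) (l i)) (f i * f j)) ->
  forall s : forall i, X (S i),
  (forall i j, kmap X (p i j) (s i) = kmap X (q i j) (s j)) ->
  exists! x : X A, forall i, kmap X (l i) x = s i.

Definition scheme X : Prop :=
  zariski_local X /\
  exists (I : Type) (R : I -> kalg K) (j : forall i, kmor (Spec (R i)) X),
    affine_open_cover j.

(* the diagonal of X is closed in X * X *)
Definition separated_scheme X : Prop :=
  forall A (x y : X A), exists I : set A, forall B (f : khom A B),
    kmap X f x = kmap X f y <-> (forall a, I a -> f a = 0).

Definition finite_type X : Prop :=
  exists (n : nat) (R : 'I_n -> kalg K) (j : forall i, kmor (Spec (R i)) X),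
    affine_open_cover j /\ forall i, alg_fg (R i).

Definition reduced X : Prop :=
  forall R (j : kmor (Spec R) X), open_immersion j -> reduced_ring R.

Definition irreducible X : Prop :=
  nonempty_subfunctor (fun A => [set: X A]) /\
  forall U V : (forall A, set (X A)),
    open_subfunctor U -> open_subfunctor V ->
    nonempty_subfunctor U -> nonempty_subfunctor V ->
    nonempty_subfunctor (fun A => U A `&` V A).

(* the dimension of X is the supremum of the Krull dimensions of the rings of
   its affine open subschemes *)
Definition dimension X (d : nat) : Prop :=
  (exists R (j : kmor (Spec R) X), open_immersion j /\ prime_chain R d) /\
  forall R (j : kmor (Spec R) X) (n : nat),
    open_immersion j -> prime_chain R n -> (n <= d)%N.

Definition curve X : Prop :=
  [/\ scheme X, separated_scheme X, finite_type X, reduced X /\ irreducible X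
    & dimension X 1].

Definition rational_points X : Type := X (base_alg K).

(* K[x,y]/(y^2 - (x - a_1)...(x - a_n)) as a quotient of K[x][y] *)
Section CoordinateRing.
Variables (n : nat) (a : 'I_n -> K).

Definition split_poly : {poly K} := \prod_(i < n) ('X - (a i)%:P).

Definition hyper_eqn : {poly {poly K}} := 'X^2 - split_poly%:P.

(* [{poly %/ h}] is the quotient by [mk_monic h] *)
Lemma mk_monic_hyper_eqn : mk_monic hyper_eqn = hyper_eqn.
Proof.
have h2 : (size (- split_poly%:P : {poly {poly K}}) < size ('X^2 : {poly {poly K}}))%N.
  by rewrite size_polyN size_polyXn ltnS (leq_trans (size_polyC_leq1 _)).
rewrite /mk_monic /hyper_eqn size_polyDl // size_polyXn /=.
by rewrite monicE lead_coefDl // lead_coefXn eqxx.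
Qed.

Definition hyper_ring : kalg K :=
  @KAlg K {poly %/ hyper_eqn}
    (qpolyC hyper_eqn \o polyC : {rmorphism K -> {poly %/ hyper_eqn}}).

End CoordinateRing.

Definition split_hyperelliptic X : Prop :=
  curve X /\
  exists (g : nat) (a : 'I_(2 * g + 2) -> K) (j : kmor (Spec (hyper_ring a)) X),
    [/\ (0 < g)%N, injective a & open_immersion j].

End Schemes.

(* Main.v *)
(* By Kummer theory, the square class of u in K* is determined by the signs with
   which the finitely many topological generators of G_K act on a square root
   of u, so K*/K*^2 is finite. Colour K by square classes. Gallai's theorem, an
   analogue of van der Waerden's theorem, gives t and d != 0 in K such that the
   elements t + d a_i all lie in one class. For x = -t/d the 2g + 2 factors
   x - a_i then lie in one class, and their product is a square because their
   number is even. Adding known abscissae to the a_i produces a new one. *)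

From HB Require Import structures.
Require Import Defs.
From mathcomp Require Import all_boot all_order all_algebra.
From mathcomp Require Import qpoly separable.
From mathcomp Require Import all_classical.
From mathcomp Require Import topology.
From mathcomp Require Import ring.

Set Implicit Arguments.
Unset Strict Implicit.
Unset Printing Implicit Defensive.

Import GRing.Theory Pdiv.CommonRing Pdiv.RingMonic.
Local Open Scope classical_set_scope.
Local Open Scope ring_scope.

(** * Extension of isomorphisms between subfields *)

Section MinimalPolynomial.
Variables (F L : fieldType) (f : {rmorphism F -> L}).
Implicit Types (p m : {poly F}) (x : L).

(** An irreducible [m] divides [p] or is coprime to it, and coprimality survives [map_poly f], which
    excludes a common root. *)
Lemma root_irreducible p m x :
  irreducible_poly m -> root (map_poly f m) x ->
  root (map_poly f p) x = (m %| p).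
Proof.
move=> m_irr mx; apply/idP/idP => [px|]; last first.
  by rewrite -(dvdp_map f) => /root_dvdp; apply.
apply: contraLR px; rewrite -irreducible_poly_coprime // -(coprimep_map f).
by move=> /coprimep_root; apply.
Qed.

Lemma exists_irreducible_root p x :
  p != 0 -> root (map_poly f p) x ->
  exists2 m, irreducible_poly m & root (map_poly f m) x.
Proof.
have [n] := ubnP (size p); elim: n p => // n IH p; rewrite ltnS => spn p0 px.
have [|nirr] := pselect (irreducible_poly p); first by exists p.
have p1 : (1 < size p)%N.
  rewrite ltnNge; apply: contraL px => /size1_polyC pE.
  by rewrite pE map_polyC rootC fmorph_eq0 -polyC_eq0 -pE.
have [q [q1 qp nqp]] : 
    exists q : {poly F}, [/\ size q != 1%N, q %| p & ~~ (q %= p)].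
  apply: contrapT => nex; apply: nirr; split=> // q q1 qp.
  by apply/negPn/negP => nqp; apply: nex; exists q.
have [r pE] := dvdpP _ _ qp.
have [r0 q0] : r != 0 /\ q != 0 by apply/andP; rewrite -negb_or -mulf_eq0 -pE.
have sqp : (size q < size p)%N.
  rewrite ltn_neqAle dvdp_leq // andbT.
  by apply: contra nqp; rewrite dvdp_size_eqp.
have srp : (size r < size p)%N.
  have q2 : (1 < size q)%N by rewrite ltn_neqAle eq_sym q1 size_poly_gt0.
  rewrite pE size_mul // -ltnS prednK ?addn_gt0 ?size_poly_gt0 ?r0 //.
  by rewrite -addn1 ltn_add2l.
move: px; rewrite pE rmorphM rootM => /orP[rx|qx].
  exact: IH (leq_trans srp spn) r0 rx.
exact: IH (leq_trans sqp spn) q0 qx.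
Qed.

End MinimalPolynomial.

Section PartialIsomorphism.
Variable L : fieldType.
Implicit Types G : set (L * L).

(* The graph of an isomorphism between two subfields of L. The symmetric
   presentation makes surjectivity the same statement as totality. *)
Definition partial_iso G : Prop :=
  [/\ G 1, forall p q, G p -> G q -> G (p - q),
      forall p q, G p -> G q -> G (p * q),
      forall p, G p -> G (p.1^-1, p.2^-1)
    & forall p, G p -> (p.1 == 0) = (p.2 == 0)].

(** The graph of the inverse isomorphism. *)
Definition flip G : set (L * L) := [set p | G (p.2, p.1)].

Lemma partial_iso_flip G : partial_iso G -> partial_iso (flip G).
Proof.
case=> G1 GB GM GV G0; split=> [//|[? ?] [? ?]|[? ?] [? ?]|[? ?]|[? ?]] /=.
- exact: GB.
- exact: GM.
- exact: GV.
- by move=> /G0 /= ->.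
Qed.

Section GraphField.
Variables (G : set (L * L)) (G_iso : partial_iso G).

(* The unused proof is an argument so that the algebraic structures on [graph]
   below can be inferred from the type. *)
Definition graph_mem of partial_iso G : {pred L * L} := fun p => `[< G p >].

Lemma graph_mem_subring : subring_closed (graph_mem G_iso).
Proof.
have [G1 GB GM _ _] := G_iso; split.
- exact/asboolP.
- by move=> p q /asboolP Gp /asboolP Gq; apply/asboolP; exact: GB.
- by move=> p q /asboolP Gp /asboolP Gq; apply/asboolP; exact: GM.
Qed.

HB.instance Definition _ :=
  GRing.isSubringClosed.Build (L * L)%type (graph_mem G_iso) graph_mem_subring.

(** The domain of the isomorphism as a field, each element being paired with its image. Of its two
    embeddings in [L], [graph_fst] is the inclusion and [graph_snd] the isomorphism itself, so a
    polynomial over the domain can be read on both sides. *)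
Record graph := Graph { graph_val :> L * L; _ : graph_mem G_iso graph_val }.

HB.instance Definition _ := [isSub for graph_val].
HB.instance Definition _ := [Choice of graph by <:].
HB.instance Definition _ := [SubChoice_isSubComNzRing of graph by <:].

Lemma graph_inv_proof (p : graph) :
  graph_mem G_iso ((val p).1^-1, (val p).2^-1).
Proof.
by case: p => p /= /asboolP Gp; have [_ _ _ GV _] := G_iso; apply/asboolP/GV.
Qed.

Definition graph_inv (p : graph) : graph := Graph (graph_inv_proof p).

Lemma graph_mulVf (p : graph) : p != 0 -> graph_inv p * p = 1.
Proof.
move=> p0; apply: val_inj; rewrite rmorphM rmorph1 /=.
case: p p0 => [[x y] Gp]; rewrite -val_eqE /=.
have [_ _ _ _ /(_ (x, y) (asboolW Gp)) /= xy0] := G_iso.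
rewrite -pair_eqE /= xy0 andbb => y0.
by congr (_, _); rewrite mulVf ?xy0.
Qed.

Lemma graph_inv0 : graph_inv 0 = 0.
Proof. by apply: val_inj => /=; rewrite !invr0. Qed.

HB.instance Definition _ :=
  GRing.ComNzRing_isField.Build graph graph_mulVf graph_inv0.

Definition graph_fst : {rmorphism graph -> L} :=
  fst \o (val : graph -> L * L)%type.
Definition graph_snd : {rmorphism graph -> L} :=
  snd \o (val : graph -> L * L)%type.

End GraphField.

Section Adjoin.
Variables (F : fieldType) (f g : {rmorphism F -> L}) (m : {poly F}) (x y : L).
Hypotheses (m_irr : irreducible_poly m).
Hypotheses (mx : root (map_poly f m) x) (my : root (map_poly g m) y).

(** The graph of the isomorphism from f(F)(x) to g(F)(y) that sends f(c) to g(c) and x to y.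
    Polynomial expressions exhaust both fields because x and y are algebraic. *)
Definition adjoin : set (L * L) :=
  range (fun p : {poly F} => ((map_poly f p).[x], (map_poly g p).[y])).

Lemma adjoin_root : adjoin (x, y).
Proof. by exists 'X; rewrite // !map_polyX !hornerX. Qed.

Lemma adjoin_const c : adjoin (f c, g c).
Proof. by exists c%:P; rewrite // !map_polyC !hornerC. Qed.

Lemma partial_iso_adjoin : partial_iso adjoin.
Proof.
have xy0 (p : {poly F}) : ((map_poly f p).[x] == 0) = ((map_poly g p).[y] == 0).
  by have := root_irreducible p m_irr mx; rewrite -(root_irreducible p m_irr my).
split=> [|_ _ [p _ <-] [q _ <-]|_ _ [p _ <-] [q _ <-]|_ [p _ <-]|_ [p _ <-]] /=.
- by exists 1; rewrite // !rmorph1 !hornerC.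
- by exists (p - q); rewrite // !rmorphB !hornerD !hornerN.
- by exists (p * q); rewrite // !rmorphM !hornerM.
- have [p0|p0] := boolP (root (map_poly f p) x).
    exists 0 => //; rewrite !rmorph0 !horner0.
    by rewrite (eqP p0); move: p0; rewrite rootE xy0 => /eqP ->; rewrite invr0.
  (* A relation u m + v p = 1 shows that v takes the inverse value of p at [x] and at [y] alike. *)
  have := p0; rewrite (root_irreducible p m_irr mx) -irreducible_poly_coprime //.
  case/Bezout_eq1_coprimepP=> -[u v] /= uv1; exists v => //.
  have inv (h : {rmorphism F -> L}) z : root (map_poly h m) z ->
      (map_poly h v).[z] * (map_poly h p).[z] = 1.
    move=> /eqP mz; have := congr1 (fun q => (map_poly h q).[z]) uv1.
    by rewrite /= rmorphD !rmorphM rmorph1 hornerD !hornerM hornerC mz mulr0 add0r.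
  have VE (a b : L) : a * b = 1 -> a = b^-1.
    move=> ab1; have b0 : b != 0.
      by apply: contraPneq ab1 => ->; rewrite mulr0 => /esym/eqP; rewrite oner_eq0.
    by apply: (mulIf b0); rewrite mulVf.
  by congr (_, _); apply: VE; exact: inv.
- exact: xy0.
Qed.

End Adjoin.

End PartialIsomorphism.

Lemma partial_iso_bigcup (L : fieldType) (C : set (set (L * L))) :
  C !=set0 -> (forall G, C G -> partial_iso G) -> total_on C subset ->
  partial_iso (\bigcup_(G in C) G).
Proof.
move=> [G0 CG0] C_iso C_tot.
have common p q : (\bigcup_(G in C) G) p -> (\bigcup_(G in C) G) q ->
    exists G, [/\ C G, G p & G q].
  move=> [G CG Gp] [H CH Hq].
  by have [GH|HG] := C_tot _ _ CG CH; [exists H|exists G]; split=> //;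
    [exact: GH|exact: HG].
split.
- by exists G0 => //; have [] := C_iso _ CG0.
- move=> p q Cp Cq; have [G [CG Gp Gq]] := common _ _ Cp Cq.
  by exists G => //; have [_ GB _ _ _] := C_iso _ CG; exact: GB.
- move=> p q Cp Cq; have [G [CG Gp Gq]] := common _ _ Cp Cq.
  by exists G => //; have [_ _ GM _ _] := C_iso _ CG; exact: GM.
- move=> p [G CG Gp].
  by exists G => //; have [_ _ _ GV _] := C_iso _ CG; exact: GV.
- by move=> p [G CG Gp]; have [_ _ _ _ G0'] := C_iso _ CG; exact: G0'.
Qed.

Section Extension.
Variables (K L : fieldType) (iota : {rmorphism K -> L}).
Implicit Types (G : set (L * L)) (x y : L).

Definition graph_over G := forall c, G (iota c, iota c).

Section Constants.
Variables (G : set (L * L)) (G_iso : partial_iso G) (G_over : graph_over G).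

Definition graph_const (c : K) : graph G_iso :=
  @Graph _ _ G_iso (iota c, iota c) (asboolT (G_over c)).

Lemma graph_const_zmod : zmod_morphism graph_const.
Proof. by move=> c d; apply: val_inj; rewrite /= !rmorphB. Qed.

Lemma graph_const_monoid : monoid_morphism graph_const.
Proof. by split=> [|c d]; apply: val_inj; rewrite /= ?rmorphM ?rmorph1. Qed.

HB.instance Definition _ :=
  GRing.isZmodMorphism.Build K (graph G_iso) graph_const graph_const_zmod.
HB.instance Definition _ :=
  GRing.isMonoidMorphism.Build K (graph G_iso) graph_const graph_const_monoid.

End Constants.

Hypothesis L_closure : separable_closure iota.

(** The minimal polynomial of [x] over the domain divides a separable polynomial over K. Its image
    under the isomorphism is therefore separable and has a root [y] in [L]. Sending [x] to [y]
    extends the isomorphism, so by maximality the pair is already in [G]. *)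
Lemma maximal_partial_iso_dom G :
  partial_iso G -> graph_over G ->
  (forall H, partial_iso H -> G `<=` H -> H `<=` G) ->
  forall x, exists y, G (x, y).
Proof.
move=> G_iso G_over G_max x.
have [p [p_irr p_sep px]] := L_closure.1 x.
pose c : {rmorphism K -> graph G_iso} := graph_const G_iso G_over.
have pE : map_poly iota p = map_poly (graph_fst G_iso) (map_poly c p).
  by rewrite -map_poly_comp.
rewrite pE in px.
have [|m m_irr mx] := exists_irreducible_root _ px.
  by rewrite map_poly_eq0 irredp_neq0.
have mp : m %| map_poly c p by rewrite -(root_irreducible _ m_irr mx).
have [||y my] := L_closure.2 (map_poly (graph_snd G_iso) m).
- by rewrite separable_map (dvdp_separable mp) // separable_map.
- by rewrite size_map_poly; exact: m_irr.1.
exists y; apply: (G_max _ (partial_iso_adjoin m_irr mx my)).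
- move=> [a b] Gab.
  exact: (adjoin_const _ _ x y (Graph (asboolT Gab : graph_mem G_iso (a, b)))).
- exact: adjoin_root.
Qed.

Lemma exists_maximal_partial_iso G0 :
  partial_iso G0 -> exists G, [/\ G0 `<=` G, partial_iso G
    & forall H, partial_iso H -> G `<=` H -> H `<=` G].
Proof.
move=> G0_iso.
have [|A [GA_iso A_max]] := @Zorn_bigcup _ [set G | partial_iso (G0 `|` G)].
  (* The chain [C] may be empty; with [G0] as an extra member, [D] is a nonempty chain. *)
  move=> C Ciso Ctot; pose D := G0 |` [set G0 `|` X | X in C].
  rewrite /=; have -> : G0 `|` \bigcup_(X in C) X = \bigcup_(X in D) X.
    rewrite bigcup_setU bigcup_set1 bigcup_image.
    apply/seteqP; split=> x.
      by case=> [?|[X CX Xx]]; [left|right; exists X => //; right].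
    by case=> [?|[X CX [?|Xx]]]; [left|left|right; exists X].
  apply: partial_iso_bigcup.
  - by exists G0; left.
  - by move=> _ [->//|[X CX <-]]; exact: Ciso.
  - move=> _ _ [->|[X CX <-]] [->|[Y CY <-]].
    + by left.
    + by left; left.
    + by right; left.
    + by have [XY|YX] := Ctot _ _ CX CY; [left|right]; apply: setUS.
exists (G0 `|` A); split=> // H H_iso GH.
apply: contrapT => nHA; apply: (A_max H).
  split; first by move=> x Ax; apply: GH; right.
  by move=> HA; apply: nHA => x /HA; right.
by rewrite /= setUidr // => x Gx; apply: GH; left.
Qed.

Lemma extend_partial_iso G0 :
  partial_iso G0 -> graph_over G0 ->
  exists s : gal iota, forall x y, G0 (x, y) -> s x = y.
Proof.
move=> /exists_maximal_partial_iso[G [G0G G_iso G_max]] G0_over.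
have G_over : graph_over G by move=> c; exact/G0G/G0_over.
have [s Gs] := choice (maximal_partial_iso_dom G_iso G_over G_max).
(* Maximality is symmetric, so the inverse isomorphism is total too; this yields surjectivity. *)
have flip_max H : partial_iso H -> flip G `<=` H -> H `<=` flip G.
  move=> /partial_iso_flip H_iso GH [y x] Hyx.
  by apply: (G_max _ H_iso) => // -[a b] Gab; exact: GH.
have [t Gt] := choice
  (maximal_partial_iso_dom (partial_iso_flip G_iso) G_over flip_max).
have [G1 GB GM _ G0'] := G_iso.
have Gfun x y z : G (x, y) -> G (x, z) -> y = z.
  move=> Gxy /(GB _ _ Gxy)/G0' /=; rewrite subrr eqxx => /esym/eqP/subr0_eq //.
have Ginj x y z : G (x, z) -> G (y, z) -> x = y.
  by move=> Gxz /(GB _ _ Gxz)/G0' /=; rewrite subrr eqxx => /eqP/subr0_eq.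
have sK : cancel s t by move=> x; apply: Ginj (Gt _) (Gs _).
have tK : cancel t s by move=> x; apply: Gfun (Gs _) (Gt _).
have sB : zmod_morphism s.
  by move=> x y; apply: Gfun (Gs _) (GB _ _ (Gs x) (Gs y)).
have sM : monoid_morphism s.
  split=> [|x y]; first exact: Gfun (Gs _) G1.
  exact: Gfun (Gs _) (GM _ _ (Gs x) (Gs y)).
have sC c : s (iota c) = iota c by apply: Gfun (Gs _) (G_over c).
exists (Gal sK tK sB sM sC) => x y /G0G; exact: Gfun.
Qed.

End Extension.

(** * Square classes *)

Section Kummer.
Variables (K L : fieldType) (iota : {rmorphism K -> L}).
Hypothesis K_char : 2%N \notin [pchar K].
Hypothesis L_closure : separable_closure iota.

Let two_neq0 : 2%:R != 0 :> L.
Proof. by rewrite -(rmorph_nat iota) fmorph_eq0; move: K_char; rewrite inE. Qed.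

Lemma separably_closed_sqrt (a : L) : exists r, r ^+ 2 = a.
Proof.
have [->|a0] := eqVneq a 0; first by exists 0; rewrite expr0n.
have [||r] := L_closure.2 ('X^2 - a%:P).
- rewrite separable_poly.unlock; apply/Bezout_eq1_coprimepP.
  (* For h = X^2 - a and h' = 2X, one has -(1/a) h + (X/(2a)) h' = 1. *)
  exists (- (a^-1)%:P, ((2%:R * a)^-1)%:P * 'X) => /=.
  rewrite derivB derivC derivXn subr0 mulrnAr.
  rewrite -mulrA -expr2 -mulrnAl -polyCMn invfM -mulrnAl -[X in X *+ 2]mul1r.
  rewrite -mulrnAl mulfV // mul1r mulNr mulrBr -polyCM mulVf //.
  by rewrite opprB subrK.
- by rewrite size_XnsubC.
by rewrite rootE !hornerE subr_eq0 => /eqP; exists r.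
Qed.

(** Otherwise X^2 - w is irreducible over K, and some automorphism sends r to -r. As it fixes r,
    this forces 2r = 0, hence r = 0, which lies in K. *)
Lemma sqrt_fixed_in_base (r : L) (w : K) :
  r ^+ 2 = iota w -> (forall s : gal iota, s r = r) -> exists k, r = iota k.
Proof.
move=> rw r_fix; apply: contrapT => rK.
have root_X2 z : z ^+ 2 = iota w -> root (map_poly iota ('X^2 - w%:P)) z.
  by move=> zw; rewrite rmorphB /= map_polyXn map_polyC rootE !hornerE zw subrr.
have m_irr : irreducible_poly ('X^2 - w%:P).
  apply: cubic_irreducible; first by rewrite size_XnsubC.
  move=> k; apply/negP; rewrite -(fmorph_root iota) => kw.
  have : r ^+ 2 == iota k ^+ 2.
    move: kw; rewrite rmorphB /= map_polyXn map_polyC rootE !hornerE.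
    by rewrite subr_eq0 => /eqP ->; rewrite rw.
  by rewrite eqf_sqr => /orP[]/eqP rk; apply: rK;
    [exists k|exists (- k); rewrite rmorphN].
have Nrw : (- r) ^+ 2 = iota w by rewrite sqrrN.
have r_root := root_X2 _ rw; have Nr_root := root_X2 _ Nrw.
have [|s sE] := extend_partial_iso L_closure
  (partial_iso_adjoin m_irr r_root Nr_root).
  exact: adjoin_const.
have := sE _ _ (adjoin_root _ _ _ _); rewrite r_fix => /eqP.
rewrite -addr_eq0 -mulr2n -mulr_natr mulf_eq0 (negPf two_neq0) orbF => /eqP r0.
by apply: rK; exists 0; rewrite rmorph0.
Qed.

(** The t with t r = s r form a nonempty open set, which meets the dense subgroup generated by [S];
    that subgroup lies in the stabilizer of [r]. *)
Lemma gal_topologically_fg_fixed (S : seq (gal iota)) (r : L) :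
  dense (smallest (@subgroup (gal iota)) [set` S]) ->
  (forall s, s \in S -> s r = r) -> forall s : gal iota, s r = r.
Proof.
move=> S_dense S_fix s.
have stab : subgroup [set t : gal iota | t r = r].
  split=> //= [t u tr ur|t tr]; first by rewrite /= ur tr.
  by rewrite -[in LHS]tr /= gal_funK.
have [||t [/= ts tS]] := S_dense [set t : gal iota | t r = s r].
- by exists s.
- by move=> t /= ts; exists [:: r] => u ut; rewrite /= ut ?inE.
by rewrite -ts; exact: (smallest_sub stab S_fix).
Qed.

Lemma finite_square_classes : gal_topologically_fg iota ->
  exists (C : finType) (c : K -> C),
    forall u v, c u = c v -> exists k, u * v = k ^+ 2.
Proof.
case=> S S_dense.
have [rt rtE] := choice (fun u => separably_closed_sqrt (iota u)).
(* The colour of u records which generators fix its chosen root. If u and v share a colour, each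
   generator fixes both roots or negates both, and so fixes their product. *)
exists _, (fun u => map_tuple (fun s : gal iota => s (rt u) == rt u) (in_tuple S)).
move=> u v /(congr1 val)/= /eq_in_map uv.
have gal_rt (s : gal iota) w : s (rt w) = rt w \/ s (rt w) = - rt w.
  have : s (rt w) ^+ 2 == rt w ^+ 2.
    by rewrite expr2 -(gal_monoid s).2 -expr2 rtE gal_fix.
  by rewrite eqf_sqr => /orP[]/eqP; [left|right].
have rt_fix s : s \in S -> s (rt u * rt v) = rt u * rt v.
  move=> /uv; rewrite (gal_monoid s).2.
  have [->|su] := gal_rt s u; have [->|sv] := gal_rt s v => //.
  - by rewrite eqxx => /esym/eqP ->.
  - by rewrite eqxx => /eqP ->.
  - by rewrite su sv mulrNN.
have [k rk] : exists k, rt u * rt v = iota k.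
  apply: (@sqrt_fixed_in_base _ (u * v)).
    by rewrite exprMn !rtE rmorphM.
  exact: gal_topologically_fg_fixed S_dense rt_fix.
exists k; apply: (fmorph_inj iota).
by rewrite rmorphM rmorphXn /= -rk exprMn !rtE.
Qed.

End Kummer.

(** * Gallai's theorem *)

Lemma infinite_notin (T : eqType) (A : set T) (s : seq T) :
  infinite_set A -> exists2 x, A x & x \notin s.
Proof.
move=> A_inf; apply: contrapT => nx; apply: A_inf.
apply: sub_finite_set (finite_seq s) => x Ax /=.
by apply/negPn/negP => xs; apply: nx; exists x.
Qed.

Section Gallai.
Variables (K : fieldType) (K_infinite : infinite_set [set: K]).
Implicit Types (S T D : seq K) (a d t s : K).

Definition homothetic S T D (C : finType) (c : K -> C) : Prop :=
  exists t d, [/\ t \in T, d \in D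
    & exists col, forall s, s \in S -> c (t + d * s) = col].

(* The translations and the ratios are confined to finite sets that do not
   depend on the colouring; otherwise the colouring of blocks in
   [exists_focused] would need infinitely many colours. *)
Definition gallai S : Prop := forall C : finType,
  exists T D, 0 \notin D /\ forall c : K -> C, homothetic S T D c.

(* [t] is the common focus of homothetic copies of S, of different colours,
   that would become copies of a :: S by adding the point t. *)
Definition focused a S T D n (C : finType) (c : K -> C) : Prop :=
  exists t (p : seq (K * C)), [/\ t \in T, size p = n,
    uniq (c t :: [seq x.2 | x <- p]), {subset [seq x.1 | x <- p] <= D}
  & forall x s, x \in p -> s \in S -> c (t + x.1 * (s - a)) = x.2].

(** It suffices that l avoids 0 and the finitely many quotients -e/d. This keeps the sums of ratios
    in [exists_focused] nonzero. *)
Lemma exists_dilation (D E : seq K) : 0 \notin D ->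
  exists2 l, l != 0 & forall d e, d \in D -> e \in E -> l * d + e != 0.
Proof.
move=> D0; pose bad := 0 :: [seq - (e / d) | e <- E, d <- D].
have [l _] := infinite_notin bad K_infinite.
rewrite inE negb_or => /andP[l0 lbad]; exists l => // d e dD eE.
have d0 : d != 0 by apply: contraNneq D0 => <-.
apply: contra lbad; rewrite addr_eq0 => /eqP lde.
apply/allpairsP; exists (e, d); split=> //=.
by rewrite -mulNr -[RHS]mulr1 -(mulfV d0); apply: (mulIf d0); rewrite lde; field.
Qed.

(** Colour focusing, by induction on n: either [a :: s0 :: S] has a monochromatic copy, or one more
    focused copy of a new colour can be found. Subtracting [a] makes the translation t the image of
    [a]. *)
Lemma exists_focused a s0 S (C : finType) n : gallai (s0 :: S) ->
  exists T D, 0 \notin D /\ forall c : K -> C,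
    homothetic [seq s - a | s <- [:: a, s0 & S]] T D c \/
    focused a (s0 :: S) T D n c.
Proof.
move=> gS; elim: n => [|n [T [D [D0 TD]]]].
  exists [:: 0], [::]; split=> // c; right.
  by exists 0, [::]; split=> //; rewrite mem_head.
(* Offsets of all points that the case n can involve. The ratio 0 puts the foci themselves in [P],
   even when [D] is empty. *)
pose P := [seq t + u | t <- T,
  u <- [seq d * (s - a) | d <- 0 :: D, s <- [:: a, s0 & S]]].
have [T' [D' [D'0 TD']]] := gS ((size P).-tuple C).
have [l l0 lD] := exists_dilation D D'0.
have P_mem t d s : t \in T -> d \in 0 :: D -> s \in [:: a, s0 & S] ->
    t + d * (s - a) \in P.
  by move=> tT dD sS; apply: (allpairs_f +%R) => //;
    apply: (allpairs_f (fun d s => d * (s - a))).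
pose D'' := [seq l * d | d <- D'] ++ [seq l * d + e | d <- D', e <- D] ++ D.
have D''0 : 0 \notin D''.
  rewrite !mem_cat !negb_or D0 andbT; apply/andP; split.
    apply/mapP => -[d dD' /esym/eqP]; rewrite mulf_eq0 (negPf l0) /= => /eqP d0.
    by rewrite -d0 dD' in D'0.
  by apply/allpairsP => -[[d e] /= [dD' eD /eqP]];
    rewrite eq_sym (negPf (lD _ _ dD' eD)).
pose T'' := [seq u + t |
  u <- [seq l * (t' + v) | t' <- T',
    v <- [seq d * s | d <- D', s <- [:: a; s0]]],
  t <- T].
exists T'', D''; split=> // c.
(* Each z is coloured by the whole block l z + P, so the blocks at [x s], for s in [s0 :: S], are
   coloured alike. *)
have [t' [d' [t'T d'D [col colE]]]] :=
  TD' (fun z => map_tuple (fun p => c (l * z + p)) (in_tuple P)).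
pose x s := l * (t' + d' * s).
have block s p : s \in s0 :: S -> p \in P -> c (x s + p) = c (x s0 + p).
  move=> sS; have : s0 \in s0 :: S by exact: mem_head.
  move=> /colE; rewrite -(colE _ sS) => /(congr1 val)/= /eq_in_map E pP.
  by rewrite -E.
have T''_mem s t : s \in [:: a; s0] -> t \in T -> x s + t \in T''.
  move=> sa tT; apply: (allpairs_f +%R) => //.
  by apply: (allpairs_f (fun t v => l * (t + v))) => //; exact: (allpairs_f *%R).
have D_D'' : {subset D <= D''} by move=> d dD; rewrite !mem_cat dD !orbT.
case: (TD (fun y => c (x s0 + y))) => [[t [d [tT dD [k kE]]]]|].
  left; exists (x s0 + t), d; split.
  - by apply: T''_mem; rewrite // !inE eqxx orbT.
  - exact: D_D''.
  - by exists k => s /kE; rewrite addrA.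
move=> [t [p [tT sp p_uniq pD pE]]].
(* The new focus lies in the block at [x a]. Moving to the block at [x s] adds l d' to each old
   ratio; the old focus gives one more copy, of ratio l d'. If [c y] is one of the colours of these
   copies, [y] completes that copy. *)
pose y := x a + t.
pose q := (l * d', c (x s0 + t)) :: [seq (l * d' + z.1, z.2) | z <- p].
have yT'' : y \in T'' by apply: T''_mem; rewrite // mem_head.
have t_P : t \in P.
  by have := P_mem t 0 a tT; rewrite mul0r addr0; apply; exact: mem_head.
have p_D z : z \in p -> z.1 \in D by move=> zp; apply: pD; exact: map_f.
have q_D : {subset [seq z.1 | z <- q] <= D''}.
  move=> d /mapP[z]; rewrite inE => /orP[/eqP-> -> /=|/mapP[w wp ->] -> /=].
    by rewrite mem_cat map_f.
  by rewrite !mem_cat (allpairs_f (fun d e => l * d + e) d'D (p_D _ wp)) orbT.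
have q_col z s : z \in q -> s \in s0 :: S -> c (y + z.1 * (s - a)) = z.2.
  rewrite inE => /orP[/eqP->|/mapP[w wp ->]] sS /=.
    by rewrite -(block _ _ sS t_P); congr c; rewrite /x /y /x; ring.
  have wP : t + w.1 * (s - a) \in P.
    by apply: P_mem; rewrite // inE ?sS ?orbT // p_D ?orbT.
  by rewrite -(pE _ _ wp sS) -(block _ _ sS wP); congr c; rewrite /y /x; ring.
have q_snd : [seq z.2 | z <- q] = c (x s0 + t) :: [seq z.2 | z <- p].
  by rewrite /= -map_comp.
have [|y_q] := boolP (c y \in [seq z.2 | z <- q]); last first.
  right; exists y, q; split=> //; first by rewrite /= size_map sp.
  by rewrite cons_uniq y_q q_snd.
move=> /mapP[z zq yz]; left; exists y, z.1; split=> //; first exact/q_D/map_f.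
exists z.2 => u /mapP[s]; rewrite inE => /orP[/eqP->|sS] ->; last exact: q_col.
by rewrite subrr mulr0 addr0.
Qed.

(** With n the number of colours, the n copies and their focus would show n + 1 distinct colours.
    The translations t - d a undo the shift by [a]. *)
Lemma gallai_cons a s0 S : gallai (s0 :: S) -> gallai [:: a, s0 & S].
Proof.
move=> gS C; have [T [D [D0 TD]]] := exists_focused a C #|C| gS.
exists [seq t - d * a | t <- T, d <- D], D; split=> // c.
have [[t [d [tT dD [k kE]]]]|[t [p [_ sp p_uniq _ _]]]] := TD c.
  exists (t - d * a), d; split=> //.
    exact: (allpairs_f (fun t d => t - d * a)).
  exists k => s sS; rewrite -(kE (s - a)); first by congr c; ring.
  exact: (map_f (fun s => s - a)).
have := max_card (mem (c t :: [seq x.2 | x <- p])).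
by rewrite (card_uniqP p_uniq) /= size_map sp ltnn.
Qed.

Lemma gallai_theorem s0 S : gallai (s0 :: S).
Proof.
elim: S s0 => [|s S IH] s0; last exact: gallai_cons.
move=> C; exists [:: 0], [:: 1]; split=> [|c]; first by rewrite inE eq_sym oner_eq0.
exists 0, 1; rewrite !mem_head; split=> //; exists (c s0) => s.
by rewrite inE => /eqP->; rewrite mul1r add0r.
Qed.

End Gallai.

(** * Points of split hyperelliptic curves *)

(* The exponent [2 * g + 2] is even, so the product is a square as soon as all
   the factors have the same square class. *)
Lemma split_poly_square_value (K : fieldType) (C : finType) (c : K -> C)
    (g : nat) (a : 'I_(2 * g + 2) -> K) (xs : seq K) :
  infinite_set [set: K] ->
  (forall u v, c u = c v -> exists k, u * v = k ^+ 2) -> injective a ->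
  exists x y, x \notin xs /\ y ^+ 2 = (split_poly a).[x].
Proof.
move=> K_inf c_sq a_inj.
have lt0 : (0 < 2 * g + 2)%N by rewrite addn2.
have lt1 : (1 < 2 * g + 2)%N by rewrite addn2.
pose i0 := Ordinal lt0; pose i1 := Ordinal lt1.
(* Including [xs] keeps the new abscissa off [xs]. The boolean separates 0, which [c_sq] cannot do
   since 0 times anything is a square. So no t + d s vanishes, as [a i0] and [a i1] have distinct
   images. *)
have [T [D [D0 TD]]] :=
  gallai_theorem K_inf (a i0) (codom a ++ xs) (C * bool)%type.
have [t [d [_ dD [col colE]]]] := TD (fun u => (c u, u == 0)).
have d0 : d != 0 by apply: contraNneq D0 => <-.
pose z s := t + d * s.
have same s : s \in codom a ++ xs ->
    c (z s) = c (z (a i0)) /\ (z s == 0) = (z (a i0) == 0).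
  move=> sS; have E := colE _ (mem_head _ _).
  by have := colE s; rewrite -E inE sS orbT => /(_ isT)[].
have zi0 : z (a i0) != 0.
  apply/negP => zi0; have [|_] := same (a i1); first by rewrite mem_cat codom_f.
  rewrite zi0 => /eqP; rewrite -(eqP zi0) => /addrI/(mulfI d0)/a_inj.
  by move=> /(congr1 val).
pose x := - t / d.
have zx s : x - s = - z s / d by rewrite /x /z; field.
have prod_sq i : exists k, z (a i) * z (a i0) = k ^+ 2.
  by apply/c_sq/(same _ _).1; rewrite mem_cat codom_f.
have [k kE] := choice prod_sq.
(* With z_i = t + d a_i and z_0 = z (a i0), the factor x - a_i = -z_i/d equals -k_i^2/(d z_0). The
   constant -1/(d z_0) occurs 2g + 2 times, hence the exponent g + 1 in the root. *)
exists x, (\prod_i k i * (- (d * z (a i0))^-1) ^+ g.+1); split.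
  apply/negP => xxs; have [|_] := same x; first by rewrite mem_cat xxs orbT.
  by rewrite (negPf zi0) /z /x mulrCA mulfV // mulr1 subrr eqxx.
rewrite /split_poly horner_prod exprMn -exprM muln2 -prodrXl.
have -> : (g.+1.*2 = #|'I_(2 * g + 2)|)%N by rewrite card_ord addn2 doubleS mul2n.
rewrite -prodr_const -big_split /=; apply: eq_bigr => i _.
by rewrite hornerXsubC zx -kE; field; rewrite d0.
Qed.

Section HyperPoint.
Variables (K : fieldType) (n : nat) (a : 'I_n -> K) (x y : K).
Hypothesis xy : y ^+ 2 = (split_poly a).[x].

Definition hyper_eval of y ^+ 2 = (split_poly a).[x] :
  {poly %/ hyper_eqn a} -> K := fun q => (val q).[y%:P].[x].

(** The defining equation vanishes at (x, y). Products in the quotient are remainders, so this makes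
    evaluation multiplicative. *)
Lemma horner_rmodp_hyper_eqn (p : {poly {poly K}}) :
  (rmodp p (mk_monic (hyper_eqn a))).[y%:P].[x] = p.[y%:P].[x].
Proof.
have h_monic := monic_mk_monic (hyper_eqn a).
rewrite {2}(rdivp_eq h_monic p) !hornerE mk_monic_hyper_eqn /hyper_eqn.
by rewrite !hornerE xy subrr mulr0 add0r.
Qed.

Lemma hyper_eval_zmod : zmod_morphism (hyper_eval xy).
Proof.
move=> p q; rewrite /hyper_eval.
have -> : val (p - q) = val p - val q by [].
by rewrite !hornerE.
Qed.

Lemma hyper_eval_monoid : monoid_morphism (hyper_eval xy).
Proof.
split=> [|p q]; first by rewrite /hyper_eval /= !hornerE.
by rewrite /hyper_eval /= horner_rmodp_hyper_eqn !hornerE.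
Qed.

HB.instance Definition _ := GRing.isZmodMorphism.Build
  {poly %/ hyper_eqn a} K (hyper_eval xy) hyper_eval_zmod.
HB.instance Definition _ := GRing.isMonoidMorphism.Build
  {poly %/ hyper_eqn a} K (hyper_eval xy) hyper_eval_monoid.

Definition hyper_point : Spec (hyper_ring a) (base_alg K).
Proof.
exists (hyper_eval xy : {rmorphism hyper_ring a -> base_alg K}).
by move=> c; rewrite /= /hyper_eval /= !hornerE.
Defined.

Definition hyper_x : hyper_ring a := qpolyC (hyper_eqn a) 'X.

Lemma hyper_point_x : (hyper_point : khom _ _) hyper_x = x.
Proof. by rewrite /= /hyper_eval /= !hornerE. Qed.

End HyperPoint.

Theorem theorem3 (K : fieldType) (K_infinite : infinite_set [set: K])
    (K_char : 2%N \notin [pchar K])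
    (Ksep : fieldType) (iota : {rmorphism K -> Ksep})
    (Ksep_closure : separable_closure iota)
    (GK_fg : gal_topologically_fg iota)
    (X : kfunctor K) (X_hyper : split_hyperelliptic X) :
  infinite_set [set: rational_points X].
Proof.
have [C [c c_sq]] := finite_square_classes K_char Ksep_closure GK_fg.
have [_ [g [a [j [_ a_inj [j_inj _]]]]]] := X_hyper.
pose abscissae : set K := [set x | exists y, y ^+ 2 = (split_poly a).[x]].
(* The abscissa of a point in the affine chart is well defined because [j] is injective; points
   outside the chart get 0. Hence every abscissa is a value of a function on the rational points. *)
have abscissa (p : rational_points X) : exists u : K,
    forall h, @kmor_fun _ _ _ j (base_alg K) h = p ->
    (h : khom _ _) (hyper_x a) = u.
  have [[h <-]|nh] := pselect (exists h, @kmor_fun _ _ _ j (base_alg K) h = p).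
    by exists ((h : khom _ _) (hyper_x a)) => h' /j_inj ->.
  by exists 0 => h hp; case: nh; exists h.
have [f fE] := choice abscissa.
move=> X_fin; have : finite_set abscissae.
  apply: sub_finite_set (finite_image f X_fin) => x [y xy].
  exists (kmor_fun j (hyper_point xy)) => //.
  by rewrite -(fE _ (hyper_point xy) erefl) hyper_point_x.
case/finite_seqP=> xs xsE.
have [x [y [xxs xy]]] := split_poly_square_value xs K_infinite c_sq a_inj.
have : abscissae x by exists y.
by rewrite xsE /= (negPf xxs).
Qed.
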